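(* Let $\mathcal{J}$ be a proper (Hermitian, non-decomposable) Jacobi matrix, and let $\mathcal{H}\in\mathbb{R}^{\infty,\infty}$ be a matrix with columns in $\ell^2(\mathbb{N}_0)$ such that $\mathcal{J}\mathcal{H}=\mathcal{H}\mathcal{J}$ (formal matrix products). Let $J$ be the self-adjoint operator determined by $\mathcal{J}$, let $\mu$ and $U$ be the measure and the unitary operator determined by $J$, and put $h:=U\mathcal{H}e_0$. Then $\mathcal{H}$ is proper if and only if the set of all polynomials $\mathbb{C}[x]$ is dense in $L^2(\mathbb{R},(|h|+1)^2\,d\mu)$. Moreover, in this case, the self-adjoint operator $H$ determined by $\mathcal{H}$ is unitarily equivalent via $U$ to the multiplication operator by the function $h$ on $L^2(\mathbb{R},d\mu)$, i.e. $$H=h(J).$$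
   Context: $\mathbb{N}_0=\{0,1,2,\dots\}$; $\{e_n\mid n\in\mathbb{N}_0\}$ is the standard basis of $\ell^2(\mathbb{N}_0)$; $\mathbb{R}^{\infty,\infty}$ is the space of semi-infinite real matrices indexed by $\mathbb{N}_0\times\mathbb{N}_0$. A Jacobi matrix $\mathcal{J}$ is a semi-infinite tridiagonal Hermitian matrix with $\mathcal{J}_{n,n}=b_n\in\mathbb{R}$, $\mathcal{J}_{n,n+1}=\mathcal{J}_{n+1,n}=a_n\in\mathbb{R}$; non-decomposable means $a_n\neq0$ for all $n$. Proper matrices: let $\mathcal{A}$ be a real symmetric semi-infinite matrix whose columns belong to $\ell^2(\mathbb{N}_0)$. Let $A_{\min}$ be the closure of the operator $x\mapsto\mathcal{A}x$ (formal matrix product) with domain $\operatorname{span}\{e_n\mid n\in\mathbb{N}_0\}$, and let $A_{\max}x=\mathcal{A}x$ with domain $\{x\in\ell^2(\mathbb{N}_0)\mid\mathcal{A}x\in\ell^2(\mathbb{N}_0)\}$. One has $(A_{\min})^*=A_{\max}$. The matrix $\mathcal{A}$ is called proper if $A_{\min}=A_{\max}$; then $A:=A_{\min}=A_{\max}$ is the unique self-adjoint operator determined by $\mathcal{A}$. (Every matrix commuting formally with a non-decomposable Jacobi matrix is symmetric, so the notion applies to $\mathcal{H}$.) For a proper Jacobi matrix $\mathcal{J}$ with corresponding self-adjoint operator $J$, there is a unique probability measure $\mu$ on $\mathbb{R}$ with finite moments such that $J$ is unitarily equivalent, via the unitary operator $U:\ell^2(\mathbb{N}_0)\to L^2(\mathbb{R},d\mu)$,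 $Ue_n=\hat P_n$ for all $n\in\mathbb{N}_0$, to the operator of multiplication by the coordinate function on $L^2(\mathbb{R},d\mu)$; here $\hat P_n$ are the polynomials orthonormal with respect to $\mu$ given by $a_{n-1}\hat P_{n-1}(x)+(b_n-x)\hat P_n(x)+a_n\hat P_{n+1}(x)=0$, $n\in\mathbb{N}_0$, $\hat P_{-1}=0$, $\hat P_0=1$ (with $a_{-1}:=0$). The multiplication operator by $h$ has domain $\{\psi\in L^2(\mathbb{R},d\mu)\mid h\psi\in L^2(\mathbb{R},d\mu)\}$, and $h(J)$ is defined by the functional calculus. *)

(* Defs.v *)
From HB Require Import structures.
From mathcomp Require Import all_boot all_order all_algebra.
From mathcomp Require Import all_classical all_reals all_analysis.
From mathcomp Require Import complex.
From mathcomp Require Import ring.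
Set Implicit Arguments.
Unset Strict Implicit.
Unset Printing Implicit Defensive.
Import Order.TTheory GRing.Theory Num.Theory.
Import numFieldNormedType.Exports.
Import ComplexField.Normc.
Local Open Scope classical_set_scope.
Local Open Scope ring_scope.
Local Open Scope complex_scope.

Section SemiInfiniteMatrices.
Context {R : realType}.

Definition infmx : Type := nat -> nat -> R.

(* Formal products are entrywise limits of partial sums.  They are used below
   only where the series converge: either finitely many terms are nonzero, or
   the rows of the matrix and the vector are square-summable. *)
Definition mul_infmx (A B : infmx) : infmx :=
  fun m n => limn (series (fun k => A m k * B k n)).

Definition app_infmx (A : infmx) (x : nat -> R[i]) : nat -> R[i] :=
  fun m => limn (series (fun k => A m k * complex.Re (x k)))
           +i* limn (series (fun k => A m k * complex.Im (x k))).

Definition symmetric_infmx (A : infmx) := forall m n, A m n = A n m.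

Definition jacobi (J : infmx) :=
  symmetric_infmx J /\ forall m n, (m.+1 < n)%N -> J m n = 0.

Definition non_decomposable (J : infmx) := forall n, J n n.+1 != 0.

Definition sqnorm_l2 (x : nat -> R[i]) : \bar R :=
  (\sum_(n <oo) (normc (x n) ^+ 2)%:E)%E.

Definition l2 : set (nat -> R[i]) := [set x | (sqnorm_l2 x < +oo)%E].

Definition l2_columns (A : infmx) := forall n, l2 (fun m => (A m n)%:C).

Definition std_basis (n : nat) : nat -> R[i] := fun m => (m == n)%:R.

Definition finite_span : set (nat -> R[i]) :=
  [set x | exists (N : nat) (c : nat -> R[i]),
     x = fun m => \sum_(n < N) c n * std_basis n m].

(* An operator in l2(N_0) is identified with its graph. *)
Definition l2_operator : Type := set ((nat -> R[i]) * (nat -> R[i])).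

Definition closure_op (A : l2_operator) : l2_operator :=
  [set xy | l2 xy.1 /\ l2 xy.2 /\
     forall eps : R, 0 < eps -> exists uv, A uv /\
       (sqnorm_l2 (fun n => (xy.1 n - uv.1 n)%R) < (eps ^+ 2)%:E)%E /\
       (sqnorm_l2 (fun n => (xy.2 n - uv.2 n)%R) < (eps ^+ 2)%:E)%E].

Definition op_min (A : infmx) : l2_operator :=
  closure_op [set xy | finite_span xy.1 /\ xy.2 = app_infmx A xy.1].

Definition op_max (A : infmx) : l2_operator :=
  [set xy | l2 xy.1 /\ l2 (app_infmx A xy.1) /\ xy.2 = app_infmx A xy.1].

Definition proper_infmx (A : infmx) :=
  symmetric_infmx A /\ l2_columns A /\ op_min A = op_max A.

(* The operator determined by A, meaningful when A is proper. *)
Definition op_of (A : infmx) : l2_operator := op_min A.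

(* (P_{n-1}, P_n), with P_{-1} = 0 and P_0 = 1 *)
Fixpoint orthopoly_pair (J : infmx) (n : nat) : {poly R} * {poly R} :=
  if n is k.+1 then
    let: (p, q) := orthopoly_pair J k in
    (q, (J k k.+1)^-1 *: (('X - (J k k)%:P) * q
          - (if k is j.+1 then J j k else 0) *: p))
  else (0, 1).

Definition orthopoly (J : infmx) (n : nat) : {poly R} := (orthopoly_pair J n).2.

Lemma orthopoly0 (J : infmx) : orthopoly J 0 = 1.
Proof. by []. Qed.

Lemma orthopoly_rec0 (J : infmx) : non_decomposable J ->
  ((J 0 0)%:P - 'X) * orthopoly J 0 + J 0 1 *: orthopoly J 1 = 0.
Proof.
move=> nd; rewrite /orthopoly /= scalerA mulfV ?nd// scale1r scale0r.
ring.
Qed.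

Lemma orthopoly_recS (J : infmx) (n : nat) : non_decomposable J ->
  J n n.+1 *: orthopoly J n + ((J n.+1 n.+1)%:P - 'X) * orthopoly J n.+1
  + J n.+1 n.+2 *: orthopoly J n.+2 = 0.
Proof.
move=> nd.
have -> : orthopoly J n.+2 = (J n.+1 n.+2)^-1 *:
    (('X - (J n.+1 n.+1)%:P) * orthopoly J n.+1 - J n n.+1 *: orthopoly J n).
  by rewrite /orthopoly /=; case: (orthopoly_pair J n).
rewrite scalerA mulfV ?nd// scale1r.
ring.
Qed.

End SemiInfiniteMatrices.
Arguments infmx : clear implicits.

Section L2Spaces.
Context {d : measure_display} {T : measurableType d} {R : realType}.

(* Stated for set functions so as to apply to weighted measures, which are
   measures only when the weight is measurable. *)
Definition sqnorm_L2 (mu : set T -> \bar R) (f : T -> R[i]) : \bar R :=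
  (\int[mu]_x (normc (f x) ^+ 2)%:E)%E.

Definition cmeasurable (f : T -> R[i]) :=
  measurable_fun setT (fun x => complex.Re (f x)) /\
  measurable_fun setT (fun x => complex.Im (f x)).

(* Functions, not classes: equality in L2 is equality mu-almost everywhere. *)
Definition L2 (mu : set T -> \bar R) : set (T -> R[i]) :=
  [set f | cmeasurable f /\ (sqnorm_L2 mu f < +oo)%E].

Definition dense_L2 (mu : set T -> \bar R) (S : set (T -> R[i])) :=
  S `<=` L2 mu /\
  forall f, L2 mu f -> forall eps : R, 0 < eps ->
    exists2 g, S g & (sqnorm_L2 mu (fun x => (f x - g x)%R) < (eps ^+ 2)%:E)%E.

(* The measure w dmu. *)
Definition weighted (mu : set T -> \bar R) (w : T -> R) : set T -> \bar R :=
  fun A => (\int[mu]_(x in A) (w x)%:E)%E.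

(* The graph of multiplication by h, with its maximal domain. *)
Definition mul_op (mu : {measure set T -> \bar R}) (h : T -> R[i]) :
    set ((T -> R[i]) * (T -> R[i])) :=
  [set fg | L2 mu fg.1 /\ L2 mu (fun x => h x * fg.1 x) /\ L2 mu fg.2 /\
     {ae mu, forall x, fg.2 x = h x * fg.1 x}].

(* Values of V outside l2 are irrelevant. *)
Definition unitary (mu : {measure set T -> \bar R})
    (V : (nat -> R[i]) -> (T -> R[i])) :=
  [/\ forall x, l2 x -> L2 mu (V x),
      forall (a : R[i]) x y, l2 x -> l2 y ->
        {ae mu, forall t, V (fun n => a * x n + y n) t = a * V x t + V y t},
      forall x, l2 x -> sqnorm_L2 mu (V x) = sqnorm_l2 x &
      forall f, L2 mu f -> exists2 x, l2 x & {ae mu, forall t, V x t = f t}].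

(* V A V^-1 = B, domains included *)
Definition equivalent_via (V : (nat -> R[i]) -> (T -> R[i]))
    (A : l2_operator) (B : set ((T -> R[i]) * (T -> R[i]))) :=
  A `<=` l2 `*` l2 /\
  forall x y, l2 x -> l2 y -> (A (x, y) <-> B (V x, V y)).

End L2Spaces.

(* B = h(A) in the Borel functional calculus, through the multiplication form
   of the spectral theorem: A is multiplication by a real function g on a
   finite measure space, and h(A) is multiplication by h o g.  The result does
   not depend on the representation chosen. *)
Definition functional_calculus {R : realType}
    (h : measurableTypeR R -> R[i]) (A B : @l2_operator R) :=
  cmeasurable h /\
  exists (d : measure_display) (T : measurableType d)
         (nu : {finite_measure set T -> \bar R})
         (V : (nat -> R[i]) -> (T -> R[i])) (g : T -> measurableTypeR R),
    [/\ measurable_fun setT g, unitary nu V,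
        equivalent_via V A (mul_op nu (fun t => (g t : R)%:C)) &
        equivalent_via V B (mul_op nu (fun t => h (g t)))].

(* The measure mu and the unitary operator U determined by J. *)
Definition spectral_data {R : realType} (J : infmx R)
    (mu : probability (measurableTypeR R) R)
    (U : (nat -> R[i]) -> (measurableTypeR R -> R[i])) :=
  [/\ forall n, mu.-integrable setT (fun x => ((x : R) ^+ n)%:E),
      unitary mu U,
      forall n, {ae mu, forall x, U (std_basis n) x = ((orthopoly J n).[x])%:C} &
      equivalent_via U (op_of J) (mul_op mu (fun x => (x : R)%:C))].

Definition polynomial_functions {R : realType} :
    set (measurableTypeR R -> R[i]) :=
  [set f | exists p : {poly R[i]}, f = fun x => p.[(x : R)%:C]].

(* Main.v *)
Require Import Defs.
From HB Require Import structures.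
From mathcomp Require Import all_boot all_order all_algebra.
From mathcomp Require Import all_classical all_reals all_analysis.
From mathcomp Require Import measurable_realfun.
From mathcomp Require Import complex.
From mathcomp Require Import ring lra.
Set Implicit Arguments.
Unset Strict Implicit.
Unset Printing Implicit Defensive.
Import Order.TTheory GRing.Theory Num.Theory.
Import numFieldNormedType.Exports HBNNSimple.
Import ComplexField.Normc.

(** Write P_n for the orthonormal polynomials of J.  The unitary U carries J to
    multiplication by x, and since H commutes with J, the images under U of the
    columns of H satisfy the three-term recurrence of the P_n, with first term h:
    U (H e_n) = h P_n (U_column).  Thus H acts on finite sequences as
    multiplication by h on polynomials.  The entries of H are the integrals of
    h P_m P_n, so H is symmetric, and h is real almost everywhere because its
    moments are.

    In L2(mu) three operators are now to be compared: the image of the minimal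
    operator of H, which is the closure of multiplication by h on polynomials
    (op_minP); multiplication by h on its maximal domain, which is self-adjoint;
    and the image of the maximal operator of H, which is the adjoint of the first
    one (op_maxP).  Each is contained in the next (op_min_sub_mul,
    mul_sub_op_max).  If H is proper, all three are equal, so U carries the operator
    of H to multiplication by h, and polynomials are a core of the latter.
    Conversely, if polynomials are a core of multiplication by h, the first two
    operators are equal, hence so are their adjoints, the third and the second
    (op_max_sub_mul), and H is proper.

    That polynomials are a core means that they are dense in the domain of
    multiplication by h for the graph norm, which is equivalent to the norm of
    L2((|h| + 1)^2 mu) (dense_weightedP).

    Adjoints are handled through inner products with test functions, so that
    neither completeness of L2 nor subsequences converging almost everywhere
    enter: a pair (psi, phi) belongs to the graph of multiplication by h as soon as
    it satisfies the adjoint relation against every f in the domain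
    (ae_mul_of_weak). *)

Local Open Scope classical_set_scope.
Local Open Scope ring_scope.
Local Open Scope complex_scope.

(** * The complex numbers as a real plane *)

Section ComplexAsPlane.
Context {R : realType}.
Implicit Types (z w a b : R[i]).

(** The real inner product of the plane, Re (z conj(w)).  Real inner products
    suffice throughout: the complex one is recovered by letting the second
    argument run through all its complex multiples. *)
Definition cdot z w : R :=
  complex.Re z * complex.Re w + complex.Im z * complex.Im w.

Lemma sqr_normcE z : normc z ^+ 2 = cdot z z.
Proof. by case: z => u v; rewrite /normc sqr_sqrtr ?addr_ge0 ?sqr_ge0// !expr2. Qed.

Lemma normc_ge0 z : 0 <= normc z.
Proof. by case: z => u v; rewrite /normc sqrtr_ge0. Qed.

Lemma sqr_normcB_le z w : normc (z - w) ^+ 2 <= 2 * (normc z ^+ 2 + normc w ^+ 2).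
Proof.
rewrite !sqr_normcE /cdot; case: z w => p q [r s] /=.
have := sqr_ge0 (p + r); have := sqr_ge0 (q + s); rewrite !expr2; lra.
Qed.

Lemma cdotMr z w a : cdot z (a * w) = cdot (conjc a * z) w.
Proof. by rewrite /cdot; case: z w a => ? ? [? ?] [? ?] /=; ring. Qed.

Lemma cdotDr z w a : cdot z (w + a) = cdot z w + cdot z a.
Proof. by rewrite /cdot; case: z w a => ? ? [? ?] [? ?] /=; ring. Qed.

Lemma cdotBl z w a : cdot (z - w) a = cdot z a - cdot w a.
Proof. by rewrite /cdot; case: z w a => ? ? [? ?] [? ?] /=; ring. Qed.

Lemma cdot_conjZ z a (r : R) : cdot (conjc z) (a * r%:C) = cdot z (conjc a * r%:C).
Proof. by rewrite /cdot; case: z a => ? ? [? ?] /=; ring. Qed.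

Lemma abs_cdot_le z w : `|cdot z w| <= normc z ^+ 2 + normc w ^+ 2.
Proof.
rewrite !sqr_normcE /cdot ler_norml.
case: z w => p q [r s] /=; apply/andP.
have := sqr_ge0 (p + r); have := sqr_ge0 (q + s).
have := sqr_ge0 (p - r); have := sqr_ge0 (q - s).
have := sqr_ge0 (p); have := sqr_ge0 (q); have := sqr_ge0 r; have := sqr_ge0 s.
by rewrite !expr2 => *; split; lra.
Qed.

Lemma sqr_normcM z w : normc (z * w) ^+ 2 = normc z ^+ 2 * normc w ^+ 2.
Proof. by rewrite normcM exprMn. Qed.

Lemma normc_real (r : R) : normc r%:C = `|r|.
Proof. by rewrite /normc /= expr0n addr0 sqrtr_sqr. Qed.

Lemma normc_opp z : normc (- z) = normc z.
Proof. by case: z => u v; rewrite /normc /= !sqrrN. Qed.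

Lemma normc_conj z : normc (conjc z) = normc z.
Proof. by case: z => u v; rewrite /normc /= sqrrN. Qed.

Lemma cdot_inj z w : (forall c, cdot z c = cdot w c) -> z = w.
Proof.
move=> zw; have := zw 1; have := zw 'i%C.
by rewrite /cdot; case: z w {zw} => ? ? [? ?] /=; rewrite !(mulr0, mulr1, addr0, add0r) => -> ->.
Qed.

End ComplexAsPlane.

(** * Square-integrable functions and their inner product *)

Section L2Theory.
Context {d : measure_display} {T : measurableType d} {R : realType}.
Context (mu : {measure set T -> \bar R}).
Implicit Types (f g : T -> R[i]) (a : R[i]).

Lemma cmeasurableD f g : cmeasurable f -> cmeasurable g ->
  cmeasurable (fun x => f x + g x).
Proof.
move=> [f1 f2] [g1 g2]; split.
- rewrite (_ : (fun x => _) = (fun x => complex.Re (f x)) \+ (fun x => complex.Re (g x))).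
    exact: measurable_funD.
  by apply/funext => x /=; case: (f x) (g x) => ? ? [].
- rewrite (_ : (fun x => _) = (fun x => complex.Im (f x)) \+ (fun x => complex.Im (g x))).
    exact: measurable_funD.
  by apply/funext => x /=; case: (f x) (g x) => ? ? [].
Qed.

Lemma cmeasurableM f g : cmeasurable f -> cmeasurable g ->
  cmeasurable (fun x => f x * g x).
Proof.
move=> [f1 f2] [g1 g2]; split.
- rewrite (_ : (fun x => _) =
    ((fun x => complex.Re (f x)) \* (fun x => complex.Re (g x))) \-
    ((fun x => complex.Im (f x)) \* (fun x => complex.Im (g x)))).
    by apply: measurable_funB; apply: measurable_funM.
  by apply/funext => x /=; case: (f x) (g x) => ? ? [].
- rewrite (_ : (fun x => _) =
    ((fun x => complex.Re (f x)) \* (fun x => complex.Im (g x))) \+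
    ((fun x => complex.Im (f x)) \* (fun x => complex.Re (g x)))).
    by apply: measurable_funD; apply: measurable_funM.
  by apply/funext => x /=; case: (f x) (g x) => ? ? [].
Qed.

Lemma cmeasurable_conj f : cmeasurable f -> cmeasurable (fun x => conjc (f x)).
Proof.
move=> [f1 f2]; split.
- by rewrite (_ : (fun x => _) = (fun x => complex.Re (f x)))//; apply/funext => x; case: (f x).
- rewrite (_ : (fun x => _) = (fun x => - complex.Im (f x))).
    exact: measurableT_comp.
  by apply/funext => x; case: (f x).
Qed.

Lemma cmeasurable_cst a : cmeasurable (fun _ : T => a).
Proof. by split; exact: measurable_cst. Qed.

Lemma cmeasurableB f g : cmeasurable f -> cmeasurable g ->
  cmeasurable (fun x => f x - g x).
Proof.
move=> mf mg; rewrite (_ : (fun x => _) = fun x => f x + (-1) * g x); last first.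
  by apply/funext => x; rewrite mulN1r.
by apply: cmeasurableD => //; apply: cmeasurableM => //; exact: cmeasurable_cst.
Qed.

Lemma cmeasurable_real (u : T -> R) : measurable_fun setT u ->
  cmeasurable (fun x => (u x)%:C).
Proof. by move=> mu_; split => //; exact: measurable_cst. Qed.

Lemma measurable_cdot f g : cmeasurable f -> cmeasurable g ->
  measurable_fun setT (fun x => cdot (f x) (g x)).
Proof.
move=> [f1 f2] [g1 g2]; rewrite /cdot.
by apply: measurable_funD; apply: measurable_funM.
Qed.

Lemma measurable_sqr_normc f : cmeasurable f ->
  measurable_fun setT (fun x => normc (f x) ^+ 2).
Proof.
move=> mf; rewrite (_ : (fun x => _) = (fun x => cdot (f x) (f x))).
  exact: measurable_cdot.
by apply/funext => x; rewrite sqr_normcE.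
Qed.

Lemma measurable_normc f : cmeasurable f ->
  measurable_fun setT (fun x => normc (f x)).
Proof.
move=> mf; rewrite (_ : (fun x => _) = (fun x => Num.sqrt (normc (f x) ^+ 2))).
  apply: (measurableT_comp (continuous_measurable_fun (@sqrt_continuous R))).
  exact: measurable_sqr_normc.
by apply/funext => x; rewrite sqrtr_sqr ger0_norm// normc_ge0.
Qed.

Lemma sqnorm_L2_ge0 f : (0 <= sqnorm_L2 mu f)%E.
Proof. by apply: integral_ge0 => x _; rewrite lee_fin sqr_ge0. Qed.

Lemma L2_fin_num f : L2 mu f -> sqnorm_L2 mu f \is a fin_num.
Proof. by case=> _ fo; rewrite ge0_fin_numE// sqnorm_L2_ge0. Qed.

Lemma le_sqnorm_L2 f g (k l : R) u : 0 <= k -> 0 <= l ->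
  cmeasurable f -> cmeasurable g -> cmeasurable u ->
  (forall x, normc (u x) ^+ 2 <= k * normc (f x) ^+ 2 + l * normc (g x) ^+ 2) ->
  (sqnorm_L2 mu u <= k%:E * sqnorm_L2 mu f + l%:E * sqnorm_L2 mu g)%E.
Proof.
move=> k0 l0 mf mg mu_ ufg.
have sq0 (v : T -> R[i]) x : setT x -> (0 <= (normc (v x) ^+ 2)%:E)%E.
  by rewrite lee_fin sqr_ge0.
have msq (v : T -> R[i]) : cmeasurable v ->
    measurable_fun setT (fun x => (normc (v x) ^+ 2)%:E).
  by move=> mv; apply/measurable_EFinP; exact: measurable_sqr_normc.
have ge0 (m : R) (v : T -> R[i]) x : 0 <= m -> setT x ->
    (0 <= m%:E * (normc (v x) ^+ 2)%:E)%E.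
  by move=> m0 _; rewrite -EFinM lee_fin mulr_ge0// sqr_ge0.
have mge0 (m : R) (v : T -> R[i]) : cmeasurable v ->
    measurable_fun setT (fun x => m%:E * (normc (v x) ^+ 2)%:E)%E.
  move=> mv; apply/measurable_EFinP/measurable_funM => //.
  exact: measurable_sqr_normc.
rewrite /sqnorm_L2 -!ge0_integralZl ?lee_fin//; try exact: msq; try exact: sq0.
rewrite -ge0_integralD//; try (by move=> x; exact: ge0); try exact: mge0.
apply: ge0_le_integral => //; try exact: msq.
- by move=> x _; rewrite lee_fin sqr_ge0.
- by apply: emeasurable_funD; exact: mge0.
- by move=> x _; rewrite -!EFinM -EFinD lee_fin.
Qed.

Lemma L2_dominated f g (k : R) : 0 <= k -> L2 mu f -> cmeasurable g ->
  (forall x, normc (g x) ^+ 2 <= k * normc (f x) ^+ 2) -> L2 mu g.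
Proof.
move=> k0 [mf fo] mg gf; split => //.
apply: (le_lt_trans (@le_sqnorm_L2 f f k 0 g _ _ _ _ _ _)) => //.
  by move=> x; rewrite mul0r addr0.
by rewrite mul0e adde0 lte_mul_pinfty.
Qed.

Lemma L2_lin a f g : L2 mu f -> L2 mu g -> L2 mu (fun x => a * f x + g x).
Proof.
move=> [mf fo] [mg go].
have mlin : cmeasurable (fun x => a * f x + g x).
  by apply: cmeasurableD => //; apply: cmeasurableM => //; exact: cmeasurable_cst.
split=> //; set k := 2 * normc a ^+ 2.
have k0 : 0 <= k by rewrite mulr_ge0// sqr_ge0.
apply: (le_lt_trans (@le_sqnorm_L2 f g k 2 _ _ _ _ _ _ _)) => //.
  move=> x; have := sqr_normcB_le (a * f x) (- g x).
  by rewrite opprK normc_opp mulrDr sqr_normcM mulrA.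
by rewrite lte_add_pinfty ?lte_mul_pinfty.
Qed.

Lemma L2D f g : L2 mu f -> L2 mu g -> L2 mu (fun x => f x + g x).
Proof.
by move=> f2 g2; have := L2_lin 1 f2 g2; under eq_fun do rewrite mul1r.
Qed.

Lemma L2B f g : L2 mu f -> L2 mu g -> L2 mu (fun x => f x - g x).
Proof.
move=> f2 g2; have := L2_lin (-1) g2 f2.
by under eq_fun do rewrite mulN1r addrC.
Qed.

Lemma L2_0 : L2 mu (fun _ => 0).
Proof.
split; first exact: cmeasurable_cst.
by rewrite /sqnorm_L2 (eq_integral (cst 0%E)) ?integral0// => x _; rewrite normc0 expr0n.
Qed.

Lemma L2Z a f : L2 mu f -> L2 mu (fun x => a * f x).
Proof. by move=> /(L2_lin a) /(_ L2_0); under eq_fun do rewrite addr0. Qed.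

Lemma sqnorm_L2_ae f g : cmeasurable f -> cmeasurable g ->
  {ae mu, forall x, f x = g x} -> sqnorm_L2 mu f = sqnorm_L2 mu g.
Proof.
move=> mf mg fg; apply: ae_eq_integral => //.
- by apply/measurable_EFinP; exact: measurable_sqr_normc.
- by apply/measurable_EFinP; exact: measurable_sqr_normc.
- by apply: filterS fg => x fgx _; rewrite fgx.
Qed.

Lemma L2_ae f g : L2 mu f -> cmeasurable g ->
  {ae mu, forall x, f x = g x} -> L2 mu g.
Proof. by move=> [mf fo] mg fg; split=> //; rewrite -(sqnorm_L2_ae mf mg fg). Qed.

Lemma sqnorm_L2_eq0 f : cmeasurable f -> sqnorm_L2 mu f = 0%E ->
  {ae mu, forall x, f x = 0}.
Proof.
move=> mf f0.
have : ae_eq mu setT (fun x => (normc (f x) ^+ 2)%:E) (cst 0%E).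
  apply/ae_eq_integral_abs => //.
    by apply/measurable_EFinP; exact: measurable_sqr_normc.
  rewrite -[RHS]f0; apply: eq_integral => x _.
  by rewrite gee0_abs// lee_fin sqr_ge0.
apply: filterS => x /(_ I) [] /eqP.
by rewrite sqrf_eq0 => /eqP /eq0_normc.
Qed.

(** The real part of the inner product of L2. *)
Definition rip f g : R := \int[mu]_x cdot (f x) (g x).

Lemma integrable_cdot f g : L2 mu f -> L2 mu g ->
  mu.-integrable setT (fun x => (cdot (f x) (g x))%:E).
Proof.
move=> f2 g2; have [[mf fo] [mg go]] := (f2, g2).
apply/integrableP; split; first by apply/measurable_EFinP; exact: measurable_cdot.
have msq (v : T -> R[i]) : cmeasurable v ->
    measurable_fun setT (fun x => (normc (v x) ^+ 2)%:E).
  by move=> mv; apply/measurable_EFinP; exact: measurable_sqr_normc.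
apply: (@le_lt_trans _ _ (sqnorm_L2 mu f + sqnorm_L2 mu g)%E); last first.
  by rewrite lte_add_pinfty.
rewrite /sqnorm_L2 -ge0_integralD//; try exact: msq;
  try by move=> x _; rewrite lee_fin sqr_ge0.
apply: ge0_le_integral => //.
- by apply/measurableT_comp => //; apply/measurable_EFinP; exact: measurable_cdot.
- by apply: emeasurable_funD; exact: msq.
- by move=> x _; rewrite -EFinD lee_fin abs_cdot_le.
Qed.

Lemma rip_sqnorm f : L2 mu f -> (rip f f)%:E = sqnorm_L2 mu f.
Proof.
move=> f2; rewrite /rip /Rintegral /sqnorm_L2.
under [in RHS]eq_integral do rewrite sqr_normcE.
by rewrite fineK//; apply: integrable_fin_num => //; exact: integrable_cdot.
Qed.

Lemma ripDr f g u : L2 mu f -> L2 mu g -> L2 mu u ->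
  rip f (fun x => g x + u x) = rip f g + rip f u.
Proof.
move=> f2 g2 u2; rewrite /rip -RintegralD//; try exact: integrable_cdot.
by apply: eq_Rintegral => x _; rewrite cdotDr.
Qed.

Lemma ripBl f g u : L2 mu f -> L2 mu g -> L2 mu u ->
  rip (fun x => f x - g x) u = rip f u - rip g u.
Proof.
move=> f2 g2 u2; rewrite /rip -RintegralB//; try exact: integrable_cdot.
by apply: eq_Rintegral => x _; rewrite cdotBl.
Qed.

Lemma ripC f g : rip f g = rip g f.
Proof. by apply: eq_Rintegral => x _; rewrite /cdot; congr (_ + _); rewrite mulrC. Qed.

Lemma rip_ae f f' g g' : cmeasurable f -> cmeasurable f' ->
  cmeasurable g -> cmeasurable g' ->
  {ae mu, forall x, f x = f' x} -> {ae mu, forall x, g x = g' x} ->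
  rip f g = rip f' g'.
Proof.
move=> mf mf' mg mg' ff' gg'; congr fine; apply: ae_eq_integral => //;
  try by apply/measurable_EFinP; exact: measurable_cdot.
by apply: filterS2 ff' gg' => x -> ->.
Qed.

(** It is through this identity that an isometry, which is only known to
    preserve norms, is seen to preserve inner products. *)
Lemma rip_polarization f g : L2 mu f -> L2 mu g ->
  2 * rip f g = fine (sqnorm_L2 mu (fun x => f x + g x))
                - fine (sqnorm_L2 mu f) - fine (sqnorm_L2 mu g).
Proof.
move=> f2 g2; rewrite -!rip_sqnorm//=; last exact: L2D.
rewrite ripDr//; last exact: L2D.
rewrite (ripC (fun x => f x + g x) f) (ripC (fun x => f x + g x) g).
rewrite !ripDr// (ripC g f); ring.
Qed.

(** A weak form of the Cauchy-Schwarz inequality, obtained by applying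
    2ab <= a^2 + b^2 to f / e and g.  Linearity in e is all that is needed to let
    the inner product tend to 0 with f. *)
Lemma abs_rip_le f g (e : R) : L2 mu f -> L2 mu g -> 0 < e ->
  (sqnorm_L2 mu f < (e ^+ 2)%:E)%E ->
  `|rip f g| <= e * (1 + fine (sqnorm_L2 mu g)).
Proof.
move=> f2 g2 e0 fe.
have ef2 := L2Z (e^-1)%:C f2.
have {fe} ef1 : rip (fun x => (e^-1)%:C * f x) (fun x => (e^-1)%:C * f x) <= 1.
  rewrite -lee_fin rip_sqnorm//.
  apply: (@le_trans _ _ ((e ^- 2)%:E * sqnorm_L2 mu f)%E).
    have := @le_sqnorm_L2 f f (e ^- 2) 0 (fun x => (e^-1)%:C * f x).
    rewrite mul0e adde0; apply => //; first by rewrite invr_ge0 sqr_ge0.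
    - by have [] := f2.
    - by have [] := f2.
    - by have [] := ef2.
    - move=> x; rewrite sqr_normcM normc_real mul0r addr0.
      by rewrite -normrX ger0_norm ?exprVn// invr_ge0 sqr_ge0.
  rewrite -(fineK (L2_fin_num f2)) -EFinM lee_fin ler_pdivrMl ?exprn_gt0// mulr1.
  by rewrite -lee_fin fineK ?ltW// L2_fin_num.
have -> : rip f g = e * rip (fun x => (e^-1)%:C * f x) g.
  rewrite /rip -RintegralZl//; last exact: integrable_cdot.
  apply: eq_Rintegral => x _; rewrite /cdot.
  case: (f x) (g x) => p q [r s] /=; field.
  by rewrite gt_eqF.
rewrite normrM (gtr0_norm e0) ler_pM2l//.
apply: (@le_trans _ _ (rip (fun x => (e^-1)%:C * f x) (fun x => (e^-1)%:C * f x) + rip g g)).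
  rewrite /rip -RintegralD//; try exact: integrable_cdot.
  apply: le_trans (le_normr_Rintegral _ _) _ => //; first exact: integrable_cdot.
  apply: le_Rintegral => //.
  - exact: (integrable_norm (integrable_cdot ef2 g2)).
  - exact: (integrableD measurableT (integrable_cdot ef2 ef2) (integrable_cdot g2 g2)).
  - by move=> x _; rewrite -!sqr_normcE abs_cdot_le.
by rewrite lerD// -rip_sqnorm.
Qed.

End L2Theory.

Lemma rip_sum_eq {d : measure_display} {T : measurableType d} {R : realType}
    (mu : {measure set T -> \bar R}) (phi psi : T -> R[i])
    (g k : nat -> T -> R[i]) (c : nat -> R[i]) N :
  L2 mu phi -> L2 mu psi -> (forall n, L2 mu (g n)) -> (forall n, L2 mu (k n)) ->
  (forall n a, rip mu phi (fun x => a * g n x) = rip mu psi (fun x => a * k n x)) ->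
  rip mu phi (fun x => \sum_(n < N) c n * g n x) =
  rip mu psi (fun x => \sum_(n < N) c n * k n x).
Proof.
move=> phi2 psi2 g2 k2 gk.
have sum2 (l : nat -> T -> R[i]) M : (forall n, L2 mu (l n)) ->
    L2 mu (fun x => \sum_(n < M) c n * l n x).
  move=> l2; elim: M => [|M IH].
    by under eq_fun do rewrite big_ord0; exact: L2_0.
  by under eq_fun do rewrite big_ord_recr; apply: L2D => //; exact: L2Z.
elim: N => [|N IH].
  have rip0 f (l : nat -> T -> R[i]) :
      rip mu f (fun x => \sum_(n < 0) c n * l n x) = 0.
    rewrite /rip; under eq_Rintegral do rewrite big_ord0 /cdot /= !mulr0 addr0.
    by rewrite Rintegral_cst// mul0r.
  by rewrite !rip0.
have recr (l : nat -> T -> R[i]) : (fun x => \sum_(n < N.+1) c n * l n x) =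
    fun x => \sum_(n < N) c n * l n x + c N * l N x.
  by apply/funext => x; rewrite big_ord_recr.
by rewrite !recr !ripDr ?IH ?gk//; try exact: sum2; exact: L2Z.
Qed.

(** * Multiplication operators and weighted spaces *)

Section WeakMultiplication.
Context {d : measure_display} {T : measurableType d} {R : realType}.
Context (mu : {measure set T -> \bar R}).
Implicit Types (f g : T -> R[i]) (a : R[i]).

Lemma L2_dominated2 f g u (k : R) : 0 <= k -> L2 mu f -> L2 mu g -> cmeasurable u ->
  (forall x, normc (u x) ^+ 2 <= k * (normc (f x) ^+ 2 + normc (g x) ^+ 2)) ->
  L2 mu u.
Proof.
move=> k0 [mf fo] [mg go] mu_ ufg; split => //.
apply: (le_lt_trans (@le_sqnorm_L2 _ _ _ mu f g k k u _ _ _ _ _ _)) => //.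
  by move=> x; rewrite -mulrDr.
by rewrite lte_add_pinfty ?lte_mul_pinfty.
Qed.

(** Membership of (psi, phi) in the graph of multiplication by h can be tested
    against the domain of that operator: this is the self-adjointness of
    multiplication operators, in the form in which it is used.  The test function
    f = (phi - h psi) / (1 + |h|^2) is in the domain because
    |phi - h psi|^2 <= 2 (1 + |h|^2) (|phi|^2 + |psi|^2), and it turns the
    hypothesis into the vanishing of the integral of
    |phi - h psi|^2 / (1 + |h|^2). *)
Lemma ae_mul_of_weak h psi phi : cmeasurable h -> L2 mu psi -> L2 mu phi ->
  (forall f, L2 mu f -> L2 mu (fun x => h x * f x) ->
     rip mu phi f = rip mu psi (fun x => conjc (h x) * f x)) ->
  {ae mu, forall x, phi x = h x * psi x}.
Proof.
move=> mh psi2 phi2 weak.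
pose u x := phi x - h x * psi x.
pose D x := 1 + normc (h x) ^+ 2.
have D1 x : 1 <= D x by rewrite lerDl sqr_ge0.
have D0 x : 0 < D x by rewrite (lt_le_trans ltr01).
have mu_ : cmeasurable u.
  apply: cmeasurableB; first by case: phi2.
  by apply: cmeasurableM => //; case: psi2.
pose f x := ((D x)^-1)%:C * u x.
have mf : cmeasurable f.
  apply: cmeasurableM => //; apply: cmeasurable_real.
  (* the inverse is measurable as a real power *)
  rewrite (_ : (fun x => _) = (fun x => D x `^ (-1))); last first.
    by apply/funext => x; rewrite powR_inv1// ltW.
  have mD : measurable_fun setT D.
    by apply: measurable_funD => //; exact: measurable_sqr_normc.
  exact: (measurableT_comp (measurable_powR (-1)) mD).
have f_le x : normc (f x) ^+ 2 * D x <= 2 * (normc (phi x) ^+ 2 + normc (psi x) ^+ 2).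
  rewrite /f sqr_normcM normc_real gtr0_norm ?invr_gt0// exprVn.
  rewrite (_ : _ * D x = (D x)^-1 * normc (u x) ^+ 2); last first.
    by field; rewrite gt_eqF.
  rewrite ler_pdivrMl//.
  apply: le_trans (sqr_normcB_le _ _) _; rewrite sqr_normcM /D.
  have := sqr_ge0 (normc (h x)); have := sqr_ge0 (normc (phi x)).
  by have := sqr_ge0 (normc (psi x)); nra.
have f2 : L2 mu f.
  apply: (L2_dominated2 (k := 2) _ phi2 psi2) => // x.
  by apply: le_trans (f_le x); rewrite ler_peMr// sqr_ge0.
have hf2 : L2 mu (fun x => h x * f x).
  apply: (L2_dominated2 (k := 2) _ phi2 psi2) => //; first exact: cmeasurableM.
  move=> x; apply: le_trans (f_le x); rewrite sqr_normcM mulrC.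
  by rewrite ler_wpM2l ?sqr_ge0// lerDr.
have chf2 : L2 mu (fun x => conjc (h x) * f x).
  apply: (L2_dominated (k := 1) _ hf2) => //.
    by apply: cmeasurableM => //; exact: cmeasurable_conj.
  by move=> x; rewrite mul1r !sqr_normcM normc_conj.
have /eqP := weak f f2 hf2; rewrite -subr_eq0 => /eqP.
rewrite /rip -RintegralB//; try exact: integrable_cdot.
under eq_Rintegral do rewrite cdotMr conjcK -cdotBl.
have intf : mu.-integrable setT (fun x => (cdot (u x) (f x))%:E).
  have := integrableB measurableT (integrable_cdot phi2 f2) (integrable_cdot psi2 chf2).
  apply: eq_integrable => // x _ /=.
  by rewrite cdotMr conjcK /= -EFinB -cdotBl.
have uf x : cdot (u x) (f x) = normc (u x) ^+ 2 / D x.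
  by rewrite sqr_normcE /f /cdot; case: (u x) => ? ? /=; ring.
move=> I0.
have : ae_eq mu setT (fun x => (cdot (u x) (f x))%:E) (cst 0%E).
  apply/ae_eq_integral_abs => //; first exact: (measurable_int mu).
  rewrite -[RHS]/(0%:E) -I0 fineK; last exact: integrable_fin_num.
  apply: eq_integral => x _; rewrite gee0_abs// lee_fin uf.
  by rewrite divr_ge0 ?sqr_ge0// ltW.
apply: filterS => x /(_ I) [] /eqP.
rewrite uf mulf_eq0 invr_eq0 (gt_eqF (D0 x)) orbF sqrf_eq0 => /eqP /eq0_normc.
by move=> /eqP; rewrite subr_eq0 => /eqP.
Qed.

(** Integration against the measure with density w.  For a simple function both
    sides are the same combination of integrals of w over its level sets, and
    monotone convergence extends this to all nonnegative measurable functions. *)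
Lemma ge0_integral_density (w : T -> R) (f : T -> \bar R) :
  measurable_fun setT w -> (forall x, 0 <= w x) ->
  measurable_fun setT f -> (forall x, 0 <= f x)%E ->
  (\int[weighted mu w]_x f x = \int[mu]_x ((w x)%:E * f x))%E.
Proof.
move=> mw w0 mf f0.
have nu0 : weighted mu w set0 = 0%E by exact: integral_set0.
have nu_ge0 A : (0 <= weighted mu w A)%E.
  by apply: integral_ge0 => x _; rewrite lee_fin.
have nu_add : semi_sigma_additive (weighted mu w).
  apply: semi_sigma_additive_nng_induced => [|x]; last by rewrite lee_fin.
  exact/measurable_EFinP.
(* the same set function, as a measure *)
pose nu : {measure set T -> \bar R} :=
  HB.pack (weighted mu w) (isMeasure.Build _ _ _ (weighted mu w) nu0 nu_ge0 nu_add).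
rewrite -[LHS]/(\int[nu]_x f x)%E.
pose s := nnsfun_approx measurableT mf.
have slim x : (fun n => (s n x)%:E) @ \oo --> f x by exact: cvg_nnsfun_approx.
have snd x : {homo (fun n => (s n x)%:E) : m n / (m <= n)%N >-> (m <= n)%E}.
  by move=> m n mn; rewrite lee_fin; exact/lefP/nd_nnsfun_approx.
transitivity (limn (fun n => \int[nu]_x (s n x)%:E)%E).
  rewrite -monotone_convergence//.
  - by apply: eq_integral => x _; apply/esym/cvg_lim => //; exact: slim.
  - by move=> n; apply/measurable_EFinP.
  - by move=> n x _; rewrite lee_fin.
transitivity (limn (fun n => \int[mu]_x ((w x)%:E * (s n x)%:E))%E); last first.
  rewrite -monotone_convergence//.
  - apply: eq_integral => x _; apply/cvg_lim => //.
    exact: cvgeZl.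
  - by move=> n; apply/measurable_EFinP; exact: measurable_funM.
  - by move=> n x _; rewrite -EFinM lee_fin mulr_ge0.
  - by move=> x _ m n mn; rewrite lee_wpmul2l// ?lee_fin//; exact: snd.
congr (limn _); apply/funext => n.
rewrite integralT_nnsfun sintegralE.
have mpre y : measurable (s n @^-1` [set y]) by exact: measurable_sfunP.
have term_ge0 y x : setT x ->
    (0 <= (w x)%:E * (y * \1_(s n @^-1` [set y]) x)%:E)%E.
  move=> _; rewrite -EFinM lee_fin mulr_ge0//.
  by have := nnfun_muleindic_ge0 (s n) y x; rewrite lee_fin.
transitivity (\int[mu]_x \sum_(y \in range (s n))
    ((w x)%:E * (y * \1_(s n @^-1` [set y]) x)%:E))%E.
  rewrite ge0_integral_fsum//; last first.
    move=> y; apply/measurable_EFinP; apply: measurable_funM => //.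
    exact: measurable_funM.
  apply: eq_fsbigr => y; rewrite inE => -[t _ sty].
  have y0 : 0 <= y by rewrite -sty.
  rewrite /= /weighted integral_mkcond -ge0_integralZl ?lee_fin//.
  - apply: eq_integral => x _; rewrite /patch /= indicE -!EFinM.
    by case: ifP => _; rewrite ?mulr0 ?mulr1 ?mule0// mulrC.
  - apply: (measurable_restrictT _ _).1 => //.
    by apply: measurable_funTS; exact/measurable_EFinP.
  - by move=> x _; rewrite /patch; case: ifP => // _; rewrite lee_fin.
apply: eq_integral => x _.
rewrite [in RHS]fimfunE -fsumEFin// ge0_mule_fsumr// => y.
exact: nnfun_muleindic_ge0.
Qed.

Lemma sqnorm_L2_weighted h f : cmeasurable h -> cmeasurable f ->
  sqnorm_L2 (weighted mu (fun x => (normc (h x) + 1) ^+ 2)) f =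
  sqnorm_L2 mu (fun x => (normc (h x) + 1)%:C * f x).
Proof.
move=> mh mf; rewrite /sqnorm_L2 ge0_integral_density//.
- apply: eq_integral => x _; rewrite sqr_normcM normc_real.
  by rewrite ger0_norm// addr_ge0// normc_ge0.
- by apply: measurable_funX; apply: measurable_funD => //; exact: measurable_normc.
- by move=> x; rewrite sqr_ge0.
- by apply/measurable_EFinP; exact: measurable_sqr_normc.
- by move=> x; rewrite lee_fin sqr_ge0.
Qed.

(** The weight is chosen so that the weighted L2 space is the domain of the
    multiplication operator: 1 and |h|^2 are at most (|h| + 1)^2, which is at most
    2 (1 + |h|^2). *)
Lemma L2_weightedP h f : cmeasurable h ->
  L2 (weighted mu (fun x => (normc (h x) + 1) ^+ 2)) f <->
  L2 mu f /\ L2 mu (fun x => h x * f x).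
Proof.
move=> mh.
have mW : cmeasurable (fun x => (normc (h x) + 1)%:C).
  by apply: cmeasurable_real; apply: measurable_funD => //; exact: measurable_normc.
have h0 x := normc_ge0 (h x).
have nW x : normc ((normc (h x) + 1)%:C * f x) ^+ 2 =
    (normc (h x) + 1) ^+ 2 * normc (f x) ^+ 2.
  by rewrite sqr_normcM normc_real ger0_norm// addr_ge0.
have f0 x := sqr_ge0 (normc (f x)).
split=> [[mf]|[f2 hf2]].
  rewrite sqnorm_L2_weighted// => Wfo.
  have Wf2 : L2 mu (fun x => (normc (h x) + 1)%:C * f x).
    by split=> //; exact: cmeasurableM.
  split; apply: (L2_dominated (k := 1) _ Wf2) => //.
  - by move=> x; rewrite mul1r nW ler_peMl// exprn_ege1// lerDr.
  - exact: cmeasurableM.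
  - by move=> x; rewrite mul1r nW sqr_normcM ler_wpM2r// ler_sqr ?nnegrE ?addr_ge0// lerDl.
have mf : cmeasurable f by case: f2.
split=> //; rewrite sqnorm_L2_weighted//.
suff [] : L2 mu (fun x => (normc (h x) + 1)%:C * f x) by [].
apply: (L2_dominated2 (k := 2) _ f2 hf2) => //; first exact: cmeasurableM.
move=> x; rewrite nW sqr_normcM; have := f0 x; have := sqr_ge0 (normc (h x) - 1).
nra.
Qed.

End WeakMultiplication.

(** * Square-summable sequences and formal matrix products *)

Section Sequences.
Context {R : realType}.
Implicit Types (x y : nat -> R[i]) (r : nat -> R) (A : infmx R).
Local Notation count := (@counting nat R).

(** Square-summable sequences form the L2 space of the counting measure, and so
    share the lemmas on L2 with functions. *)
Lemma sqnorm_l2E x : sqnorm_l2 x = sqnorm_L2 (@counting nat R) x.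
Proof.
by rewrite /sqnorm_L2 ge0_integral_count// => k; rewrite lee_fin sqr_ge0.
Qed.

Lemma cmeasurable_nat x : cmeasurable x.
Proof. by split. Qed.

Lemma l2E x : l2 x <-> L2 (@counting nat R) x.
Proof.
rewrite /l2 /L2 /= sqnorm_l2E; split=> [|[]//]; split=> //; exact: cmeasurable_nat.
Qed.

Lemma l2_lin (a : R[i]) x y : l2 x -> l2 y -> l2 (fun n => a * x n + y n).
Proof. by rewrite !l2E; exact: L2_lin. Qed.

Lemma l2B x y : l2 x -> l2 y -> l2 (fun n => x n - y n).
Proof. by rewrite !l2E; exact: L2B. Qed.

(** Integrability against the counting measure is absolute convergence, without
    which the limit of the partial sums could exist and not be the integral. *)
Lemma Rintegral_count (u : nat -> R) : count.-integrable setT (EFin \o u) ->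
  \int[count]_k u k = limn (series u).
Proof.
move=> intu.
have sumu : summable setT (EFin \o u).
  rewrite /summable; have [_] := integrableP _ _ _ intu.
  rewrite ge0_integral_count// nneseries_esum//.
  by rewrite (_ : [set _ | _] = setT)//; apply/seteqP; split.
have cvgu : cvgn (series u).
  apply: normed_cvg.
  have := @summable_cvg R xpredT (fun k => `|u k|%:E) (fun _ _ => normr_ge0 _).
  apply; rewrite /summable; under eq_esum do rewrite /= normr_id.
  suff <- : [set: nat] = (fun=> is_true true) by [].
  by apply/funext => k; apply/propext; split.
rewrite /Rintegral integral_count// -[RHS]/(fine (limn (series u))%:E).
rewrite -EFin_lim//; congr (fine (limn _)); apply/funext => n /=.
by rewrite /series /= sumEFin.
Qed.

Lemma limn_series_finite (u : nat -> R) (N : nat) :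
  (forall k, (N <= k)%N -> u k = 0) -> limn (series u) = \sum_(k < N) u k.
Proof.
move=> u0; apply: cvg_lim => //; apply: cvg_near_cst.
exists N => // n /= Nn; rewrite /series /= (big_cat_nat (leq0n N) Nn)//=.
rewrite [X in _ + X]big_nat_cond [X in _ + X]big1 ?addr0 ?big_mkord//.
by move=> i /andP[/andP[Ni _] _]; exact: u0.
Qed.

Lemma app_infmx_real A r m : app_infmx A (fun k => (r k)%:C) m =
  (limn (series (fun k => A m k * r k)))%:C.
Proof.
rewrite /app_infmx; congr (_ +i* _) => /=.
under eq_fun do rewrite mulr0.
by rewrite (@limn_series_finite _ 0) ?big_ord0.
Qed.

Lemma rip_realZ x r (c : R[i]) : l2 x -> l2 (fun k => (r k)%:C) ->
  rip count x (fun k => c * (r k)%:C) =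
  complex.Re c * limn (series (fun k => r k * complex.Re (x k))) +
  complex.Im c * limn (series (fun k => r k * complex.Im (x k))).
Proof.
move=> /l2E x2 /l2E r2.
have int1 : count.-integrable setT (EFin \o (fun k => r k * complex.Re (x k))).
  have := integrable_cdot x2 r2; apply: eq_integrable => // k _ /=.
  by rewrite /cdot /= mulr0 addr0 mulrC.
have int2 : count.-integrable setT (EFin \o (fun k => r k * complex.Im (x k))).
  have := integrable_cdot x2 (L2Z 'i r2); apply: eq_integrable => // k _ /=.
  by rewrite /cdot /=; congr _%:E; ring.
rewrite -!Rintegral_count// -!RintegralZl// -RintegralD//.
- apply: eq_Rintegral => k _; rewrite /cdot; case: c (x k) => ? ? [? ?] /=.
  by rewrite !(mulr0, subr0, add0r); ring.
- have := integrableZl measurableT (complex.Re c) int1.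
  by apply: eq_integrable => // k _; rewrite /= EFinM.
- have := integrableZl measurableT (complex.Im c) int2.
  by apply: eq_integrable => // k _; rewrite /= EFinM.
Qed.

(** The formal product is defined by two real series; they are recovered from the
    real inner product by letting c be 1 or i. *)
Lemma rip_row A x m (c : R[i]) : l2 x -> l2 (fun k => (A m k)%:C) ->
  rip count x (fun k => c * (A m k)%:C) = cdot (app_infmx A x m) c.
Proof.
move=> x2 A2; rewrite rip_realZ// /cdot /=.
by rewrite ![complex.Re c * _]mulrC ![complex.Im c * _]mulrC.
Qed.

Lemma std_basisE n k : std_basis n k = ((k == n)%:R : R)%:C.
Proof. by rewrite /std_basis; case: eqP. Qed.

Lemma l2_finite x (N : nat) : (forall k, (N <= k)%N -> x k = 0) -> l2 x.
Proof.
move=> x0; rewrite /l2 /= /sqnorm_l2.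
rewrite (_ : (\sum_(_ <oo) _)%E = (limn (series (fun k => normc (x k) ^+ 2)))%:E).
  by rewrite ltry.
rewrite (@limn_series_finite _ N); last by move=> k /x0 ->; rewrite normc0 expr0n.
apply: cvg_lim => //; apply: cvg_near_cst; exists N => // n /= Nn.
rewrite sumEFin; congr _%:E; rewrite (big_cat_nat (leq0n N) Nn)//=.
rewrite [X in _ + X]big_nat_cond [X in _ + X]big1 ?addr0 ?big_mkord//.
by move=> i /andP[/andP[Ni _] _]; rewrite x0// normc0 expr0n.
Qed.

Lemma l2_std_basis n : l2 (std_basis n : nat -> R[i]).
Proof.
by apply: (@l2_finite _ n.+1) => k nk; rewrite /std_basis gtn_eqF.
Qed.

Lemma rip_std_basis x m (c : R[i]) : l2 x ->
  rip count x (fun k => c * std_basis m k) = cdot (x m) c.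
Proof.
move=> x2; pose I1 : infmx R := fun m k => (k == m)%:R.
rewrite (_ : (fun k => _) = (fun k => c * (I1 m k)%:C)); last first.
  by apply/funext => k; rewrite std_basisE.
rewrite rip_row//; last first.
  have := l2_std_basis m; congr l2; apply/funext => k; exact: std_basisE.
congr cdot; rewrite /app_infmx.
have one (u : nat -> R) : limn (series (fun k => I1 m k * u k)) = u m.
  rewrite (@limn_series_finite _ m.+1); last first.
    by move=> k mk; rewrite /I1 gtn_eqF// mul0r.
  rewrite big_ord_recr /= /I1 eqxx mul1r big1 ?add0r// => i _.
  by rewrite ltn_eqF ?mul0r.
by rewrite !one; case: (x m).
Qed.

Lemma app_infmx_span A (c : nat -> R[i]) N m :
  app_infmx A (fun k => \sum_(n < N) c n * std_basis n k) m =
  \sum_(n < N) c n * (A m n)%:C.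
Proof.
have xk k : \sum_(n < N) c n * std_basis n k = if (k < N)%N then c k else 0.
  have [kN|Nk] := ltnP k N.
    rewrite (bigD1 (Ordinal kN))//= /std_basis eqxx mulr1 big1 ?addr0// => i.
    by rewrite -val_eqE /= eq_sym => /negbTE ->; rewrite mulr0.
  rewrite big1// => i _; rewrite /std_basis gtn_eqF ?mulr0//.
  exact: leq_trans Nk.
rewrite /app_infmx !(@limn_series_finite _ N);
  try by move=> k Nk; rewrite xk ltnNge Nk /= mulr0.
have ReD : {morph @complex.Re R : a b / a + b} by case=> ? ? [].
have ImD : {morph @complex.Im R : a b / a + b} by case=> ? ? [].
apply/eqP; rewrite eq_complex /=; apply/andP; split; apply/eqP.
- rewrite (big_morph _ ReD (id1 := 0))//; apply: eq_bigr => k _.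
  by rewrite xk ltn_ord; case: (c k) => ? ? /=; rewrite mulr0 subr0 mulrC.
- rewrite (big_morph _ ImD (id1 := 0))//; apply: eq_bigr => k _.
  by rewrite xk ltn_ord; case: (c k) => ? ? /=; rewrite mulr0 add0r mulrC.
Qed.

Lemma app_infmx_std_basis A n : app_infmx A (std_basis n) = fun m => (A m n)%:C.
Proof.
apply/funext => m; rewrite (_ : std_basis n = fun k => ((k == n)%:R : R)%:C); last first.
  by apply/funext => k; exact: std_basisE.
rewrite app_infmx_real; congr _%:C.
rewrite (@limn_series_finite _ n.+1); last first.
  by move=> k nk; rewrite gtn_eqF// mulr0.
rewrite big_ord_recr /= eqxx mulr1 big1 ?add0r// => i _.
by rewrite ltn_eqF ?mulr0.
Qed.

End Sequences.

(** * Unitary operators from sequences to functions *)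

Section Unitary.
Context {d : measure_display} {T : measurableType d} {R : realType}.
Context (mu : {measure set T -> \bar R}) (V : (nat -> R[i]) -> (T -> R[i])).
Context (uV : unitary mu V).
Implicit Types (x y : nat -> R[i]).
Local Notation count := (@counting nat R).

Lemma unitary_L2 x : l2 x -> L2 mu (V x).
Proof. by case: uV => + _ _ _; apply. Qed.

Lemma unitary_rip x y : l2 x -> l2 y -> rip mu (V x) (V y) = rip count x y.
Proof.
move=> x2 y2; have [V2 Vlin Viso _] := uV.
have xy2 : l2 (fun n => x n + y n) by move: x2 y2; rewrite !l2E; exact: L2D.
apply: (@mulfI _ 2); first by rewrite pnatr_eq0.
rewrite !rip_polarization; try exact: V2; try exact/l2E.
rewrite -(@sqnorm_l2E R (fun k => x k + y k)) -(sqnorm_l2E x) -(sqnorm_l2E y).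
rewrite -!Viso//; congr (fine _ - _ - _).
have [m1 _] := V2 _ xy2; have m2 := (L2D (V2 _ x2) (V2 _ y2)).1.
apply: sqnorm_L2_ae => //.
have := Vlin 1 x y x2 y2.
rewrite (_ : (fun n => 1 * x n + y n) = fun n => x n + y n); last first.
  by apply/funext => n; rewrite mul1r.
by apply: filterS => t ->; rewrite mul1r.
Qed.

Lemma unitary0 : {ae mu, forall t, V (fun _ => 0) t = 0}.
Proof.
have z2 : l2 (fun _ => 0 : R[i]) by apply: (@l2_finite _ _ 0).
have [V2 _ Viso _] := uV.
apply: sqnorm_L2_eq0; first by case: (V2 _ z2).
rewrite Viso// /sqnorm_l2 eseries0// => n _ _.
by rewrite normc0 expr0n.
Qed.

Lemma unitaryZ (a : R[i]) x : l2 x ->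
  {ae mu, forall t, V (fun n => a * x n) t = a * V x t}.
Proof.
have z2 : l2 (fun _ => 0 : R[i]) by apply: (@l2_finite _ _ 0).
move=> x2; have [_ Vlin _ _] := uV.
have := Vlin a x _ x2 z2.
rewrite (_ : (fun n => a * x n + 0) = fun n => a * x n); last first.
  by apply/funext => n; rewrite addr0.
by move=> H; apply: filterS2 H unitary0 => t -> ->; rewrite addr0.
Qed.

Lemma unitaryB x y : l2 x -> l2 y ->
  {ae mu, forall t, V (fun n => x n - y n) t = V x t - V y t}.
Proof.
move=> x2 y2; have [_ Vlin _ _] := uV.
have := Vlin (-1) y x y2 x2.
rewrite (_ : (fun n => -1 * y n + x n) = fun n => x n - y n); last first.
  by apply/funext => n; rewrite mulN1r addrC.
by apply: filterS => t ->; rewrite mulN1r addrC.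
Qed.

Lemma unitary_sum (v : nat -> nat -> R[i]) (f : nat -> T -> R[i])
    (c : nat -> R[i]) N :
  (forall n, l2 (v n)) -> (forall n, {ae mu, forall t, V (v n) t = f n t}) ->
  l2 (fun m => \sum_(n < N) c n * v n m) /\
  {ae mu, forall t, V (fun m => \sum_(n < N) c n * v n m) t =
                    \sum_(n < N) c n * f n t}.
Proof.
move=> v2 Vv; have [_ Vlin _ _] := uV.
elim: N => [|N [s2 IH]].
  split; first by apply: (@l2_finite _ _ 0) => k _; rewrite big_ord0.
  rewrite (_ : (fun m => _) = fun _ => 0); last by apply/funext => k; rewrite big_ord0.
  by apply: filterS unitary0 => t ->; rewrite big_ord0.
rewrite (_ : (fun m => _) = fun m => c N * v N m + \sum_(n < N) c n * v n m); last first.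
  by apply/funext => k; rewrite big_ord_recr addrC.
split; first exact: l2_lin.
have H := Vlin (c N) _ _ (v2 N) s2.
apply: filterS3 IH H (Vv N) => t e1 -> ->.
by rewrite e1 big_ord_recr addrC.
Qed.

Lemma sqnorm_unitaryB x u f : l2 x -> l2 u -> cmeasurable f ->
  {ae mu, forall t, V u t = f t} ->
  sqnorm_L2 mu (fun t => V x t - f t) = sqnorm_l2 (fun n => x n - u n).
Proof.
move=> x2 u2 mf Vu; have [V2 _ Viso _] := uV.
rewrite -Viso; last exact: l2B.
apply: sqnorm_L2_ae.
- have [m1 _] := V2 _ x2.
  exact: cmeasurableB.
- by case: (V2 _ (l2B x2 u2)).
- by apply: filterS2 Vu (unitaryB x2 u2) => t <- ->.
Qed.

Lemma unitary_ripZ x y f (c : R[i]) : l2 x -> l2 y -> cmeasurable f ->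
  {ae mu, forall t, V y t = f t} ->
  rip mu (V x) (fun t => c * f t) = rip count x (fun k => c * y k).
Proof.
move=> x2 y2 mf Vyf; have [V2 _ _ _] := uV.
have cy2 : l2 (fun k => c * y k) by exact/l2E/L2Z/l2E.
rewrite -unitary_rip//; have [mx _] := V2 _ x2.
apply: rip_ae => //.
- by apply: cmeasurableM => //; exact: cmeasurable_cst.
- by case: (V2 _ cy2).
- exact: aeW.
- by apply: filterS2 Vyf (unitaryZ c y2) => t <- ->.
Qed.

(** The images of the basis vectors are total: a function orthogonal to all of
    them is the image of a sequence with zero entries. *)
Lemma unitary_weak0 f : L2 mu f ->
  (forall m (c : R[i]), rip mu f (fun t => c * V (std_basis m) t) = 0) ->
  {ae mu, forall t, f t = 0}.
Proof.
move=> f2 f0; have [V2 _ _ Vsurj] := uV; have [y y2 Vy] := Vsurj _ f2.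
have y0 : y = fun _ => 0.
  apply/funext => m; apply: cdot_inj => c.
  rewrite -rip_std_basis// [RHS]/cdot /= !mul0r addr0 -(f0 m c).
  have [me _] := V2 _ (@l2_std_basis R m); have [my _] := V2 _ y2.
  rewrite -(@unitary_ripZ _ _ (V (std_basis m)))//; last 2 first.
  - exact: l2_std_basis.
  - exact: aeW.
  apply: rip_ae => //.
  - by case: f2.
  - by apply: cmeasurableM => //; exact: cmeasurable_cst.
  - by apply: cmeasurableM => //; exact: cmeasurable_cst.
  - exact: aeW.
by apply: filterS2 Vy unitary0 => t <-; rewrite y0.
Qed.

End Unitary.

(** * Orthogonal polynomials of a Jacobi matrix *)

(** Cancelling the leading term of p with q_N lowers the degree. *)
Lemma poly_comb_of_sizes (F : fieldType) (q : nat -> {poly F}) :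
  (forall n, size (q n) = n.+1) ->
  forall N (p : {poly F}), (size p <= N)%N ->
    exists c : nat -> F, p = \sum_(n < N) c n *: q n.
Proof.
move=> sq; elim=> [|N IH] p pN.
  by exists (fun=> 0); rewrite big_ord0; apply/eqP; rewrite -size_poly_eq0 -leqn0.
pose a := p`_N / lead_coef (q N).
have [|c pc] := IH (p - a *: q N).
  apply/leq_sizeP => j; rewrite leq_eqVlt => /predU1P[<-|Nj]; rewrite coefB coefZ.
    rewrite /a lead_coefE sq /= divfK ?subrr//.
    by have := lead_coef_eq0 (q N); rewrite lead_coefE sq /= => ->; rewrite -size_poly_eq0 sq.
  by rewrite !nth_default ?mulr0 ?subr0// ?sq//; exact: leq_trans pN _.
exists (fun n => if n == N then a else c n).
rewrite big_ord_recr /= eqxx; apply/eqP; rewrite -subr_eq pc; apply/eqP.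
by apply: eq_bigr => i _; rewrite ltn_eqF.
Qed.

Section JacobiPolynomials.
Context {R : realType}.
Context (J : infmx R) (nd : non_decomposable J).

(** The off-diagonal entry a_{n-1}, with a_{-1} = 0.  Together with the
    truncated predecessor it lets the recurrences be written without a case
    distinction on n. *)
Definition prev_offdiag n : R := if n is k.+1 then J k n else 0.

Lemma orthopolyS n : orthopoly J n.+1 = (J n n.+1)^-1 *:
  (('X - (J n n)%:P) * orthopoly J n - prev_offdiag n *: orthopoly J n.-1).
Proof.
case: n => [|n]; first by rewrite /orthopoly /= !scale0r.
by rewrite /orthopoly /=; case: (orthopoly_pair J n).
Qed.

Lemma size_orthopoly n : size (orthopoly J n) = n.+1.
Proof.
suff [] : size (orthopoly J n) = n.+1 /\ size (orthopoly J n.+1) = n.+2 by [].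
have sizeS k : size (orthopoly J k) = k.+1 ->
    (size (prev_offdiag k *: orthopoly J k.-1) < k.+2)%N ->
    size (orthopoly J k.+1) = k.+2.
  move=> sk sp; rewrite orthopolyS size_scale ?invr_eq0//.
  have sX : size (('X - (J k k)%:P) * orthopoly J k) = k.+2.
    rewrite size_mul ?polyXsubC_eq0 -?size_poly_eq0 ?sk//.
    by rewrite size_XsubC.
  by rewrite size_polyDl sX// size_polyN.
elim: n => [|n [IH1 IH2]].
  split; first by rewrite orthopoly0 size_poly1.
  by apply: sizeS; rewrite ?orthopoly0 ?size_poly1// /prev_offdiag scale0r size_poly0.
split=> //; apply: sizeS => //=.
by apply: leq_ltn_trans (size_scale_leq _ _) _; rewrite IH1.
Qed.

Definition corthopoly n : {poly R[i]} := map_poly (real_complex R) (orthopoly J n).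

Lemma corthopolyE n (x : R) : (corthopoly n).[x%:C] = ((orthopoly J n).[x])%:C.
Proof. exact: horner_map. Qed.

Lemma orthopoly_span (p : {poly R[i]}) :
  exists N (c : nat -> R[i]), p = \sum_(n < N) c n *: corthopoly n.
Proof.
have [c pc] := poly_comb_of_sizes
  (fun n => etrans (size_map_poly (real_complex R) _) (size_orthopoly n)) (leqnn (size p)).
by exists (size p), c.
Qed.

Lemma mul_jacobi (H : infmx R) m n : jacobi J -> mul_infmx H J m n =
  J n n.+1 * H m n.+1 + (J n n * H m n + prev_offdiag n * H m n.-1).
Proof.
move=> [Jsym Jtri]; rewrite /mul_infmx (@limn_series_finite _ _ n.+2); last first.
  by move=> k nk; rewrite Jsym Jtri// mulr0.
rewrite !big_ord_recr /= (Jsym n.+1) [_ * J n n.+1]mulrC [_ * J n n]mulrC.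
rewrite [RHS]addrC; congr (_ + _); rewrite addrC; congr (_ + _).
case: n => [|n]; first by rewrite big_ord0 mul0r.
rewrite big_ord_recr /= [_ * J n n.+1]mulrC big1 ?add0r// => i _.
by rewrite Jtri ?mulr0// ltnS.
Qed.

End JacobiPolynomials.

(** * Polynomials as a core of a multiplication operator *)

Section PolynomialCore.
Context {R : realType} (mu : {measure set (measurableTypeR R) -> \bar R}).
Implicit Types (h : measurableTypeR R -> R[i]).
Local Notation pol p := (fun x : measurableTypeR R => p.[(x : R)%:C]).

Lemma cmeasurable_poly (p : {poly R[i]}) :
  cmeasurable (fun x : measurableTypeR R => p.[(x : R)%:C]).
Proof.
elim/poly_ind: p => [|p c IH].
  by under eq_fun do rewrite horner0; exact: cmeasurable_cst.
under eq_fun do rewrite hornerMXaddC.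
apply: cmeasurableD; last exact: cmeasurable_cst.
apply: cmeasurableM => //; apply: cmeasurable_real; exact: measurable_id.
Qed.

(** The closure of the graph of multiplication by h restricted to polynomials;
    it is the image of the minimal operator of the commuting matrix. *)
Definition mul_poly_closure h :
    set ((measurableTypeR R -> R[i]) * (measurableTypeR R -> R[i])) :=
  [set fg | forall eps : R, 0 < eps -> exists p : {poly R[i]},
    (sqnorm_L2 mu (fun t => (fg.1 t - p.[(t : R)%:C])%R) < (eps ^+ 2)%:E)%E /\
    (sqnorm_L2 mu (fun t => (fg.2 t - h t * p.[(t : R)%:C])%R) < (eps ^+ 2)%:E)%E].

Lemma mul_poly_closure_ae h f f' g g' : cmeasurable h ->
  cmeasurable f -> cmeasurable f' -> cmeasurable g -> cmeasurable g' ->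
  {ae mu, forall t, f t = f' t} -> {ae mu, forall t, g t = g' t} ->
  mul_poly_closure h (f, g) -> mul_poly_closure h (f', g').
Proof.
move=> mh mf mf' mg mg' ff' gg' fg eps e0; have [p [/= fp gp]] := fg _ e0.
have mp := cmeasurable_poly p.
have mhp : cmeasurable (fun t => h t * pol p t) by exact: cmeasurableM.
exists p => /=; split.
- rewrite (@sqnorm_L2_ae _ _ _ mu _ (fun t => f t - pol p t))//;
    try exact: cmeasurableB.
  by apply: filterS ff' => t ->.
- rewrite (@sqnorm_L2_ae _ _ _ mu _ (fun t => g t - h t * pol p t))//;
    try exact: cmeasurableB.
  by apply: filterS gg' => t ->.
Qed.

(** The weighted norm of f is equivalent to the graph norm of (f, h f), so that
    density of the polynomials in the weighted space says that they form a core
    of multiplication by h. *)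
Lemma dense_weightedP h : cmeasurable h ->
  (forall p, L2 mu (pol p) /\ L2 mu (fun x => h x * pol p x)) ->
  dense_L2 (weighted mu (fun x => (normc (h x) + 1) ^+ 2)) polynomial_functions <->
  (forall f, L2 mu f -> L2 mu (fun t => h t * f t) ->
     mul_poly_closure h (f, fun t => h t * f t)).
Proof.
move=> mh polL2; have mpol p : cmeasurable (pol p) by exact: cmeasurable_poly.
have h0 x : 0 <= normc (h x) by exact: normc_ge0.
have wE f p : cmeasurable f ->
    sqnorm_L2 (weighted mu (fun x => (normc (h x) + 1) ^+ 2)) (fun t => f t - pol p t) =
    sqnorm_L2 mu (fun t => (normc (h t) + 1)%:C * (f t - pol p t)).
  by move=> mf; rewrite sqnorm_L2_weighted//; exact: cmeasurableB.
have nW (z : R[i]) t : normc ((normc (h t) + 1)%:C * z) ^+ 2 =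
    (normc (h t) + 1) ^+ 2 * normc z ^+ 2.
  by rewrite sqr_normcM normc_real ger0_norm// addr_ge0.
have mW : cmeasurable (fun x => (normc (h x) + 1)%:C).
  by apply: cmeasurable_real; apply: measurable_funD => //; exact: measurable_normc.
split=> [[_ dense] f f2 hf2 eps e0|approx].
  have mf : cmeasurable f by case: f2.
  have [_ [p ->]] := dense f ((L2_weightedP _ _ mh).2 (conj f2 hf2)) _ e0.
  rewrite wE// => lt_eps; exists p.
  have mfp : cmeasurable (fun t => f t - pol p t) by exact: cmeasurableB.
  have mWfp : cmeasurable (fun t => (normc (h t) + 1)%:C * (f t - pol p t)).
    exact: cmeasurableM.
  have le1 u : cmeasurable u ->
      (forall t, normc (u t) ^+ 2 <= normc ((normc (h t) + 1)%:C * (f t - pol p t)) ^+ 2) ->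
      (sqnorm_L2 mu u < (eps ^+ 2)%:E)%E.
    move=> mu_ le_u; apply: le_lt_trans lt_eps.
    apply: ge0_le_integral => //.
    - by move=> t _; rewrite lee_fin sqr_ge0.
    - by apply/measurable_EFinP; exact: measurable_sqr_normc.
    - by apply/measurable_EFinP; exact: measurable_sqr_normc.
    - by move=> t _; rewrite lee_fin.
  split; apply: le1 => //.
  - by move=> t; rewrite nW ler_peMl ?sqr_ge0// exprn_ege1// lerDr.
  - by apply: cmeasurableB; apply: cmeasurableM.
  - move=> t; rewrite -mulrBr nW sqr_normcM ler_wpM2r ?sqr_ge0//.
    by rewrite ler_sqr ?nnegrE ?addr_ge0// lerDl.
split; first by move=> _ [p ->]; apply/L2_weightedP => //; exact: polL2.
move=> f /(L2_weightedP _ _ mh)[f2 hf2] eps e0.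
have mf : cmeasurable f by case: f2.
have e2 : 0 < eps / 2 by rewrite divr_gt0.
have [p [fp hfp]] := approx _ f2 hf2 _ e2.
exists (pol p); first by exists p.
rewrite wE//.
apply: (@le_lt_trans _ _ (2%:E * sqnorm_L2 mu (fun t => f t - pol p t)%R +
    2%:E * sqnorm_L2 mu (fun t => h t * f t - h t * pol p t)%R)%E).
  apply: le_sqnorm_L2 => //.
  - exact: cmeasurableB.
  - by apply: cmeasurableB; apply: cmeasurableM.
  - by apply: cmeasurableM => //; exact: cmeasurableB.
  - move=> t; rewrite nW -mulrBr sqr_normcM.
    have := sqr_ge0 (normc (f t - pol p t)); have := sqr_ge0 (normc (h t) - 1).
    nra.
rewrite (_ : eps ^+ 2 = 2 * (eps / 2) ^+ 2 + 2 * (eps / 2) ^+ 2); last by field.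
rewrite [X in (_ < X)%E]EFinD [X in (_ < X + X)%E]EFinM.
by apply: lteD; rewrite lte_pmul2l.
Qed.

End PolynomialCore.

(** * Matrices commuting with a Jacobi matrix *)

Lemma eq0_of_le_eps {R : realType} (a k : R) :
  (forall e, 0 < e -> `|a| <= e * k) -> a = 0.
Proof.
move=> ak; apply/eqP; rewrite -normr_le0; apply/ler_addgt0Pl => e e0.
rewrite addr0; have k0 : 0 <= k.
  by have := ak 1 ltr01; rewrite mul1r; apply: le_trans.
apply: le_trans (ak (e / (k + 1)) _) _; first by rewrite divr_gt0// ltr_pwDr.
rewrite mulrAC ler_pdivrMr ?ltr_pwDr// ler_pM2l//; lra.
Qed.

Section Commutant.
Context {R : realType}.
Context (J H : infmx R) (mu : probability (measurableTypeR R) R)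
  (U : (nat -> R[i]) -> (measurableTypeR R -> R[i])).
Context (jacobi_J : jacobi J) (nondec_J : non_decomposable J)
  (proper_J : proper_infmx J) (columns_H : l2_columns H)
  (JH_comm : mul_infmx J H = mul_infmx H J) (spectral_J : spectral_data J mu U).

Local Notation col n := (fun m => (H m n)%:C).
Local Notation h := (U (col 0)).
Local Notation P n := (fun x : measurableTypeR R => (corthopoly J n).[(x : R)%:C]).
Local Notation pol p := (fun x : measurableTypeR R => p.[(x : R)%:C]).

Let uU : unitary mu U. Proof. by case: spectral_J. Qed.

Let h2 : L2 mu h. Proof. exact: (unitary_L2 uU). Qed.

Let mh : cmeasurable h. Proof. by case: h2. Qed.

Lemma U_std_basis n : {ae mu, forall x, U (std_basis n) x = P n x}.
Proof.
have [_ _ + _] := spectral_J => /(_ n).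
by apply: filterS => x ->; rewrite corthopolyE.
Qed.

Lemma L2_corthopoly n : L2 mu (P n).
Proof.
apply: L2_ae (U_std_basis n); last exact: cmeasurable_poly.
by apply: (unitary_L2 uU); exact: l2_std_basis.
Qed.

Lemma app_jacobi_column n : app_infmx J (col n) =
  fun m => (J n n.+1)%:C * (H m n.+1)%:C +
           ((J n n)%:C * (H m n)%:C + (prev_offdiag J n)%:C * (H m n.-1)%:C).
Proof.
apply/funext => m; rewrite app_infmx_real.
rewrite -!(rmorphM (real_complex R)) -!(rmorphD (real_complex R)) -mul_jacobi//.
by rewrite -JH_comm.
Qed.

(** The heart of the matter.  Since J is proper, each column of H, whose image
    under J is again square-summable by commutation, lies in the domain of the
    operator of J, where U turns J into multiplication by x.  The images of the
    columns thus satisfy the recurrence of the orthogonal polynomials, which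
    determines them from the first one, h. *)
Lemma U_column n : {ae mu, forall x, U (col n) x = h x * P n x}.
Proof.
have [_ _ _ [_ equivJ]] := spectral_J.
have [_ Ulin _ _] := uU.
(* the recurrence has two terms in its past; for n = 0 they coincide *)
suff [] : {ae mu, forall x, U (col n) x = h x * P n x} /\
          {ae mu, forall x, U (col n.-1) x = h x * P n.-1 x} by [].
elim: n => [|n [IH IH1]].
  suff h0 : {ae mu, forall x, h x = h x * P 0%N x} by [].
  by apply: aeW => x; rewrite corthopolyE orthopoly0 hornerC mulr1.
split=> //.
have pc2 : l2 (fun m => (prev_offdiag J n)%:C * (H m n.-1)%:C).
  by apply/l2E/L2Z/l2E; exact: columns_H.
have lin2 := l2_lin (J n n)%:C (columns_H n) pc2.
have app2 : l2 (app_infmx J (col n)).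
  by rewrite app_jacobi_column; exact: l2_lin (columns_H n.+1) lin2.
have [_ [_ [_ UJ]]] : mul_op mu (fun x => (x : R)%:C) (U (col n), U (app_infmx J (col n))).
  apply/equivJ => //; rewrite /op_of.
  have [_ [_ ->]] := proper_J.
  by split; [exact: columns_H|].
have E1 := Ulin (J n n.+1)%:C _ _ (columns_H n.+1) lin2.
have E2 := Ulin (J n n)%:C _ _ (columns_H n) pc2.
have E3 := unitaryZ uU (prev_offdiag J n)%:C (columns_H n.-1).
rewrite /= app_jacobi_column in UJ.
apply: filterS3 (filterI IH IH1) (filterI E1 E2) (filterI E3 UJ).
move=> x [e0 e1] [e2 e3] [e4 e5].
have : (J n n.+1)%:C * U (col n.+1) x = (J n n.+1)%:C * (h x * P n.+1 x).
  have -> : (J n n.+1)%:C * U (col n.+1) x = (x : R)%:C * U (col n) x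
      - ((J n n)%:C * U (col n) x + (prev_offdiag J n)%:C * U (col n.-1) x).
    by rewrite -e5 e2 e3 e4 addrK.
  rewrite e0 e1 !corthopolyE [orthopoly J n.+1]orthopolyS hornerZ.
  rewrite [((_)^-1 * _)%:C]rmorphM /= [(J n n.+1)%:C * _]mulrCA [(J n n.+1)%:C * _]mulrA.
  rewrite -rmorphM /= mulfV// mul1r hornerD hornerN hornerM hornerZ hornerXsubC.
  rewrite rmorphB !rmorphM /= rmorphB /=; ring.
apply: mulfI.
by have := nondec_J n; rewrite -(fmorph_eq0 (real_complex R)).
Qed.

Lemma cmeasurable_symbol_corthopoly n : cmeasurable (fun x => h x * P n x).
Proof. by apply: cmeasurableM => //; exact: cmeasurable_poly. Qed.

Lemma L2_symbol_corthopoly n : L2 mu (fun x => h x * P n x).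
Proof.
apply: L2_ae (U_column n); last exact: cmeasurable_symbol_corthopoly.
exact: (unitary_L2 uU).
Qed.

Lemma rip_U_std_basis x m (c : R[i]) : l2 x ->
  rip mu (U x) (fun t => c * P m t) = cdot (x m) c.
Proof.
move=> x2; rewrite (unitary_ripZ uU c x2 (l2_std_basis m) _ (U_std_basis m)).
  exact: rip_std_basis.
exact: cmeasurable_poly.
Qed.

(** As the P_n are real, the right-hand side is symmetric in m and n: this is
    where the symmetry of H comes from. *)
Lemma commutant_entryE m n :
  H m n = rip mu (fun x => h x * P n x) (fun x => 1 * P m x).
Proof.
have := rip_U_std_basis m 1 (columns_H n); rewrite /cdot /= mulr1 mulr0 addr0 => <-.
have [mc _] := unitary_L2 uU (columns_H n).
have mP : cmeasurable (fun x => 1 * P m x).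
  by apply: cmeasurableM; [exact: cmeasurable_cst|exact: cmeasurable_poly].
apply: rip_ae => //; [exact: cmeasurable_symbol_corthopoly|exact: U_column|exact: aeW].
Qed.

Lemma commutant_symmetric : symmetric_infmx H.
Proof.
move=> m n; rewrite !commutant_entryE; apply: eq_Rintegral => x _.
by rewrite !corthopolyE /cdot; case: (h x) => p q /=; ring.
Qed.

(** The moments of h against the P_m are the entries of the first column of H,
    hence real, so that h and its conjugate have the same ones; and moments
    determine a function, the P_m being total. *)
Lemma symbol_real : {ae mu, forall x, conjc (h x) = h x}.
Proof.
have ch2 : L2 mu (fun x => conjc (h x)).
  apply: (L2_dominated (k := 1) _ h2) => //; first exact: cmeasurable_conj.
  by move=> x; rewrite normc_conj mul1r.
suff: {ae mu, forall x, conjc (h x) - h x = 0}.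
  by apply: filterS => x /eqP; rewrite subr_eq0 => /eqP.
apply: (unitary_weak0 uU); first exact: L2B.
move=> m c; have P2 := L2Z c (L2_corthopoly m); have [mP _] := P2.
have [mh' _] := L2B ch2 h2.
transitivity (rip mu (fun x => conjc (h x) - h x) (fun t => c * P m t)).
  apply: rip_ae => //.
  - have [me _] := unitary_L2 uU (@l2_std_basis R m).
    by apply: cmeasurableM => //; exact: cmeasurable_cst.
  - exact: aeW.
  - by apply: filterS (U_std_basis m) => x ->.
rewrite ripBl// rip_U_std_basis ?columns_H//.
have -> : rip mu (fun x => conjc (h x)) (fun t => c * P m t) =
    rip mu h (fun t => conjc c * P m t).
  by apply: eq_Rintegral => x _; rewrite corthopolyE cdot_conjZ.
by rewrite rip_U_std_basis ?columns_H// /cdot; case: (c) => ? ? /=; ring.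
Qed.

(** The operator of H with maximal domain is the adjoint of the one with minimal
    domain: its graph is defined by testing against the columns of H. *)
Lemma op_maxP x y : l2 x -> l2 y ->
  op_max H (x, y) <-> forall m c,
    rip mu (U y) (fun t => c * P m t) = rip mu (U x) (fun t => c * (h t * P m t)).
Proof.
move=> x2 y2.
have appE m c : rip mu (U x) (fun t => c * (h t * P m t)) = cdot (app_infmx H x m) c.
  rewrite (unitary_ripZ uU c x2 (columns_H m) (cmeasurable_symbol_corthopoly m) (U_column m)).
  rewrite -rip_row//.
    by congr (rip _ _ _); apply/funext => k; rewrite commutant_symmetric.
  by rewrite (_ : (fun k => _) = col m)//; apply/funext => k; rewrite commutant_symmetric.
split=> [[_ [_ /= yE]] m c|weak].
  by rewrite appE rip_U_std_basis// yE.
suff yE : y = app_infmx H x by split=> //; split=> //; rewrite /= -yE.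
apply/funext => m; apply: cdot_inj => c.
by rewrite -appE -weak rip_U_std_basis.
Qed.

Lemma U_span (c : nat -> R[i]) N : let u := fun m => \sum_(n < N) c n * std_basis n m in
  let p := \sum_(n < N) c n *: corthopoly J n in
  [/\ l2 u, l2 (app_infmx H u), {ae mu, forall x, U u x = pol p x} &
      {ae mu, forall x, U (app_infmx H u) x = h x * pol p x}].
Proof.
move=> u p.
have [u2 Uu] := unitary_sum uU c N (@l2_std_basis R) U_std_basis.
have [v2 Uv] := unitary_sum uU c N columns_H U_column.
have pE x : pol p x = \sum_(n < N) c n * P n x.
  by rewrite /p horner_sum; apply: eq_bigr => i _; rewrite hornerZ.
have -> : app_infmx H u = fun m => \sum_(n < N) c n * (H m n)%:C.
  by apply/funext => m; rewrite app_infmx_span.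
split=> //; first by apply: filterS Uu => x ->; rewrite pE.
by apply: filterS Uv => x ->; rewrite pE mulr_sumr; apply: eq_bigr => i _; rewrite mulrCA.
Qed.

Lemma cmeasurable_symbol_pol p : cmeasurable (fun x => h x * pol p x).
Proof. by apply: cmeasurableM => //; exact: cmeasurable_poly. Qed.

Lemma L2_pol p : L2 mu (pol p) /\ L2 mu (fun x => h x * pol p x).
Proof.
have [N [c ->]] := orthopoly_span nondec_J p.
have [u2 v2 Uu Uv] := U_span c N.
split.
- exact: L2_ae (unitary_L2 uU u2) (cmeasurable_poly _) Uu.
- exact: L2_ae (unitary_L2 uU v2) (cmeasurable_symbol_pol _) Uv.
Qed.

Lemma op_minP x y : l2 x -> l2 y ->
  op_min H (x, y) <-> mul_poly_closure mu h (U x, U y).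
Proof.
move=> x2 y2; split=> [[_ [_ cl]] eps e0|approx].
  have [[u v] /= [[[N [c uE]] vE] [xu yv]]] := cl _ e0.
  subst u v.
  have [u2 v2 Uu Uv] := U_span c N.
  exists (\sum_(n < N) c n *: corthopoly J n); split.
  - by rewrite (sqnorm_unitaryB uU x2 u2 (cmeasurable_poly _) Uu).
  - by rewrite (sqnorm_unitaryB uU y2 v2 (cmeasurable_symbol_pol _) Uv).
split=> //; split=> // eps e0; have [p [xp yp]] := approx _ e0.
have [N [c pE]] := orthopoly_span nondec_J p; subst p.
have [u2 v2 Uu Uv] := U_span c N.
set u := (fun m => _) in u2 v2 Uu Uv.
exists (u, app_infmx H u) => /=; split; first by split=> //; exists N, c.
split.
- by rewrite -(sqnorm_unitaryB uU x2 u2 (cmeasurable_poly _) Uu).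
- by rewrite -(sqnorm_unitaryB uU y2 v2 (cmeasurable_symbol_pol _) Uv).
Qed.

Lemma mul_opP x y : l2 x -> l2 y ->
  mul_op mu h (U x, U y) <-> {ae mu, forall t, U y t = h t * U x t}.
Proof.
move=> x2 y2; have Ux2 := unitary_L2 uU x2; have Uy2 := unitary_L2 uU y2.
split=> [[_ [_ []]]//|yE]; split=> //; split; last by split.
apply: L2_ae Uy2 _ yE; apply: cmeasurableM => //; exact: Ux2.1.
Qed.

(** Multiplication by h is symmetric because h is real. *)
Lemma mul_sub_op_max x y : l2 x -> l2 y ->
  {ae mu, forall t, U y t = h t * U x t} -> op_max H (x, y).
Proof.
move=> x2 y2 yE; apply/op_maxP => // m c.
have [mx _] := unitary_L2 uU x2; have [my _] := unitary_L2 uU y2.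
have mcP : cmeasurable (fun t => c * P m t).
  by apply: cmeasurableM; [exact: cmeasurable_cst|exact: cmeasurable_poly].
have mchP : cmeasurable (fun t => c * (h t * P m t)).
  by apply: cmeasurableM; [exact: cmeasurable_cst|exact: cmeasurable_symbol_corthopoly].
congr fine; apply: ae_eq_integral => //;
  try by apply/measurable_EFinP; exact: measurable_cdot.
apply: filterS2 yE symbol_real => t -> hr _; congr _%:E.
by rewrite mulrCA [RHS]cdotMr hr.
Qed.

(** Multiplication by h extends its restriction to polynomials and is closed;
    in the weak formulation closedness needs no convergent subsequence. *)
Lemma op_min_sub_mul x y : l2 x -> l2 y -> op_min H (x, y) ->
  {ae mu, forall t, U y t = h t * U x t}.
Proof.
move=> x2 y2 /op_minP-/(_ x2 y2) approx.
have Ux2 := unitary_L2 uU x2; have Uy2 := unitary_L2 uU y2.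
apply: ae_mul_of_weak => // f f2 hf2.
have chf2 : L2 mu (fun x => conjc (h x) * f x).
  apply: (L2_dominated (k := 1) _ hf2) => //.
    by apply: cmeasurableM; [exact: cmeasurable_conj|case: f2].
  by move=> t; rewrite mul1r !sqr_normcM normc_conj.
apply/eqP; rewrite -subr_eq0; apply/eqP.
pose k := (1 + fine (sqnorm_L2 mu f)) + (1 + fine (sqnorm_L2 mu (fun x => conjc (h x) * f x))).
apply: (@eq0_of_le_eps _ _ k) => e e0.
have [p [xp yp]] := approx _ e0; have [p2 hp2] := L2_pol p.
have -> : rip mu (U y) f - rip mu (U x) (fun x => conjc (h x) * f x) =
    rip mu (fun t => U y t - h t * pol p t) f -
    rip mu (fun t => U x t - pol p t) (fun x => conjc (h x) * f x).
  rewrite !ripBl//.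
  have -> : rip mu (fun t => h t * pol p t) f = rip mu (pol p) (fun x => conjc (h x) * f x).
    by apply: eq_Rintegral => t _; rewrite cdotMr conjcK.
  ring.
apply: le_trans (ler_normB _ _) _; rewrite /k mulrDr lerD//.
- by apply: abs_rip_le => //; exact: L2B.
- by apply: abs_rip_le => //; exact: L2B.
Qed.

(** If multiplication by h is the closure of its restriction to polynomials, the
    adjoint of that restriction is the adjoint of multiplication by h, that is,
    multiplication by h itself. *)
Lemma op_max_sub_mul x y :
  (forall f, L2 mu f -> L2 mu (fun t => h t * f t) ->
     mul_poly_closure mu h (f, fun t => h t * f t)) ->
  l2 x -> l2 y -> op_max H (x, y) ->
  {ae mu, forall t, U y t = h t * U x t}.
Proof.
move=> dense x2 y2 /op_maxP-/(_ x2 y2) weak.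
have Ux2 := unitary_L2 uU x2; have Uy2 := unitary_L2 uU y2.
apply: ae_mul_of_weak => // f f2 hf2.
have -> : rip mu (U x) (fun t => conjc (h t) * f t) = rip mu (U x) (fun t => h t * f t).
  have [mx _] := Ux2; have [mf _] := f2.
  apply: rip_ae => //.
  - by apply: cmeasurableM => //; exact: cmeasurable_conj.
  - exact: cmeasurableM.
  - exact: aeW.
  - by apply: filterS symbol_real => t ->.
apply/eqP; rewrite -subr_eq0; apply/eqP.
pose k := (1 + fine (sqnorm_L2 mu (U y))) + (1 + fine (sqnorm_L2 mu (U x))).
apply: (@eq0_of_le_eps _ _ k) => e e0.
have [p [fp hfp]] := dense _ f2 hf2 _ e0; have [p2 hp2] := L2_pol p.
have polE : rip mu (U y) (pol p) = rip mu (U x) (fun t => h t * pol p t).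
  have [N [c ->]] := orthopoly_span nondec_J p.
  have := rip_sum_eq c N Uy2 Ux2 L2_corthopoly L2_symbol_corthopoly weak.
  set g := (fun t => _); set k1 := (fun t => _) => gk.
  transitivity (rip mu (U y) g).
    congr (rip _ _ _); apply/funext => t; rewrite horner_sum.
    by apply: eq_bigr => i _; rewrite hornerZ.
  rewrite gk; congr (rip _ _ _); apply/funext => t; rewrite horner_sum.
  by rewrite mulr_sumr; apply: eq_bigr => i _; rewrite hornerZ mulrCA.
have -> : rip mu (U y) f - rip mu (U x) (fun t => h t * f t) =
    rip mu (fun t => f t - pol p t) (U y) -
    rip mu (fun t => h t * f t - h t * pol p t) (U x).
  rewrite !ripBl// !(ripC _ _ (U y)) !(ripC _ _ (U x)) polE; ring.
apply: le_trans (ler_normB _ _) _; rewrite /k mulrDr lerD//.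
- by apply: abs_rip_le => //; exact: L2B.
- by apply: abs_rip_le => //; exact: L2B.
Qed.

Lemma proper_equivalent_mul : proper_infmx H ->
  equivalent_via U (op_of H) (mul_op mu h).
Proof.
move=> [_ [_ minmax]]; split; first by move=> [x y] [x2 [y2 _]].
move=> x y x2 y2; rewrite mul_opP// /op_of; split; first exact: op_min_sub_mul.
by rewrite minmax; exact: mul_sub_op_max.
Qed.

Lemma proper_functional_calculus : proper_infmx H ->
  functional_calculus h (op_of J) (op_of H).
Proof.
move=> properH; split=> //; have [_ _ _ equivJ] := spectral_J.
exists _, (measurableTypeR R), mu, U, id.
by split=> //; exact: proper_equivalent_mul.
Qed.

Lemma proper_iff_dense : proper_infmx H <->
  dense_L2 (weighted mu (fun x => (normc (h x) + 1) ^+ 2)) polynomial_functions.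
Proof.
have [_ _ _ Usurj] := uU.
split=> [[_ [_ minmax]]|/(dense_weightedP mh L2_pol) dense].
  apply/(dense_weightedP mh L2_pol) => f f2 hf2.
  have [x x2 Ux] := Usurj _ f2; have [y y2 Uy] := Usurj _ hf2.
  have [mx _] := unitary_L2 uU x2; have [my _] := unitary_L2 uU y2.
  have [mf _] := f2; have [mhf _] := hf2.
  apply: (mul_poly_closure_ae _ _ _ _ _ Ux Uy) => //.
  apply/op_minP => //; rewrite minmax; apply: mul_sub_op_max => //.
  by apply: filterS2 Ux Uy => t -> ->.
split; first exact: commutant_symmetric.
split=> //; apply/seteqP; split=> -[x y].
  move=> Hxy; have [x2 [y2 _]] := Hxy.
  by apply: mul_sub_op_max => //; exact: op_min_sub_mul.
move=> Hxy; have [x2 [appx yE]] := Hxy.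
have y2 : l2 y by move: yE => /= ->.
have Uyx := op_max_sub_mul dense x2 y2 Hxy.
have Ux2 := unitary_L2 uU x2; have Uy2 := unitary_L2 uU y2.
have [mx _] := Ux2; have [my _] := Uy2.
have mhx : cmeasurable (fun t => h t * U x t) by exact: cmeasurableM.
have hUx2 : L2 mu (fun t => h t * U x t) by exact: L2_ae Uy2 mhx Uyx.
apply/op_minP => //.
apply: (mul_poly_closure_ae mh mx mx mhx my _ _ (dense _ Ux2 hUx2)).
- exact: aeW.
- by apply: filterS Uyx => t ->.
Qed.

End Commutant.

Local Close Scope complex_scope.
Local Close Scope classical_set_scope.

Theorem theorem13 (R : realType) (J H : infmx R)
    (jacobi_J : jacobi J) (nondec_J : non_decomposable J) (proper_J : proper_infmx J)
    (columns_H : l2_columns H)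
    (JH_comm : mul_infmx J H = mul_infmx H J)
    (mu : probability (measurableTypeR R) R)
    (U : (nat -> R[i]) -> (measurableTypeR R -> R[i]))
    (spectral_J : spectral_data J mu U) :
  let h := U (app_infmx H (std_basis 0)) in
  (proper_infmx H <->
     dense_L2 (weighted mu (fun x => (normc (h x) + 1) ^+ 2))
              polynomial_functions) /\
  (proper_infmx H ->
     equivalent_via U (op_of H) (mul_op mu h) /\
     functional_calculus h (op_of J) (op_of H)).
Proof.
move=> h; have hE : h = U (fun m => (H m 0%N)%:C%C).
  by rewrite /h app_infmx_std_basis.
rewrite hE; split.
  exact: (proper_iff_dense jacobi_J nondec_J proper_J columns_H JH_comm spectral_J).
move=> properH; split.
  exact: (proper_equivalent_mul jacobi_J nondec_J proper_J columns_H JH_comm spectral_J).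
exact: (proper_functional_calculus jacobi_J nondec_J proper_J columns_H JH_comm spectral_J).
Qed.
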